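(* Let $J\subset\mathbb R$ be an interval, let $\alpha_1,\dots,\alpha_m\colon J\to\mathbb R$ be continuous functions linearly independent on $J$, let $A_1,\dots,A_m$ be pairwise commuting real constant $n\times n$ matrices, let $B_j=A_j^{T}$, and let $f\colon J\to\mathbb R^n$ be continuous. Let $\zeta\in\{1,\dots,m\}$ and assume: (i) $\nu^{0}$ is a common real eigenvector of the matrices $B_j$ corresponding to the eigenvalues $\lambda^{j}$, $j=1,\dots,m$; (ii) $\nu^{\theta}$, $\theta=1,\dots,s-1$, are real generalized eigenvectors (of order $\theta$) of the matrix $B_\zeta$ corresponding to the eigenvalue $\lambda^{\zeta}$ with elementary divisor of multiplicity $s\geq2$. Let $\mathscr X$ be a domain contained in $\{x\in\mathbb R^n\colon\nu^{0}x\neq0\}$, and let $\Psi^{\zeta}_\theta\colon\mathscr X\to\mathbb R$, $\theta=1,\dots,s-1$, be the solution of the functional system $$\nu^{\theta}x=\sum_{\rho=1}^{\theta}\binom{\theta-1}{\rho-1}\Psi^{\zeta}_\rho(x)\,\nu^{\theta-\rho}x\quad\text{for all }x\in\mathscr X,\quad\theta=1,\dots,s-1.$$ Assume further: (iii) for no $j\in\{1,\dots,m\}$, $j\neq\zeta$, and no $\theta\in\{1,\dots,s-1\}$ is the function $x\mapsto\mathfrak a_j\Psi^{\zeta}_\theta(x)$, $x\in\mathscr X$, a nonconstant first integral of the system $\dfrac{dx}{dt}=A_\zeta x$. Let $\mu^{j\zeta}_\theta$ denote the constant value (under these hypotheses) of $\mathfrak a_j\Psi^{\zeta}_\theta$ on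 $\mathscr X$, $j=1,\dots,m$, and put $\mu^{\zeta}_\theta(t)=\sum_{j=1}^{m}\mu^{j\zeta}_\theta\,\alpha_j(t)$ for $t\in J$, $\theta=1,\dots,s-1$. Fix $t_0\in J$ and define, for $t\in J$, $$\varphi(t)=\exp\Bigl(-\int_{t_0}^{t}\sum_{j=1}^{m}\lambda^{j}\alpha_j(\tau)\,d\tau\Bigr),$$ $$K^{\theta}_{\rho-1}(t)=\int_{t_0}^{t}\Bigl(\binom{\theta}{\rho-1}\mu^{\zeta}_{\theta-\rho+1}(\tau)+\sum_{\eta=1}^{\theta-\rho}\binom{\theta}{\eta}\mu^{\zeta}_\eta(\tau)\,K^{\theta-\eta}_{\rho-1}(\tau)\Bigr)d\tau,\quad\rho=1,\dots,\theta,\ \theta=1,\dots,s-1,$$ $$C_\theta(t)=\int_{t_0}^{t}\Bigl(\nu^{\theta}f(\tau)\,\varphi(\tau)+\sum_{\rho=1}^{\theta}\binom{\theta}{\rho}\mu^{\zeta}_\rho(\tau)\,C_{\theta-\rho}(\tau)\Bigr)d\tau,\quad\theta=0,\dots,s-1.$$ Then the (nonhomogeneous Lappo-Danilevskii) system $\dfrac{dx}{dt}=\sum_{j=1}^{m}\alpha_j(t)A_jx+f(t)$ has on the domain $J\times\mathscr X$ the first integrals $$F_\theta\colon(t,x)\mapsto\nu^{\theta}x\,\varphi(t)-\sum_{\rho=1}^{\theta}K^{\theta}_{\rho-1}(t)\,F_{\rho-1}(t,x)-C_\theta(t),\quad\theta=0,\dots,s-1.$$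
   Context: A domain is an open arcwise connected set. For a vector $\nu=(\nu_1,\dots,\nu_n)$ and $x\in\mathbb R^n$, $\nu x=\sum_{\xi=1}^n\nu_\xi x_\xi$; vectors are regarded as columns when multiplied by $B_j$. The operators are $\mathfrak a_j=\sum_{\xi=1}^n(A_jx)_\xi\,\partial_{x_\xi}$. Given an eigenvector $\nu^0$ of $B_\zeta$ with eigenvalue $\lambda^\zeta$ with elementary divisor of multiplicity $s$, generalized eigenvectors $\nu^{\theta}$ of order $\theta$ are non-zero vectors satisfying $(B_\zeta-\lambda^{\zeta}E)\nu^{\theta}=\theta\,\nu^{\theta-1}$, $\theta=1,\dots,s-1$, $E$ the identity matrix. A first integral of $dx/dt=X(t,x)$ on a domain $G'$ is a continuously differentiable function $F\colon G'\to\mathbb R$ with $\partial_tF+\sum_{\xi=1}^nX_\xi\,\partial_{x_\xi}F=0$ on $G'$ (for an autonomous function $F(x)$ and system $dx/dt=A_\zeta x$ this reads $\mathfrak a_\zeta F=0$). Empty sums are zero. *)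

(* Defs.v *)
From mathcomp Require Export all_boot all_order all_algebra.
From mathcomp Require Export all_classical all_reals all_analysis.
Export Order.TTheory GRing.Theory Num.Theory.
Export numFieldNormedType.Exports.

Set Implicit Arguments.
Unset Strict Implicit.
Unset Printing Implicit Defensive.

Local Open Scope classical_set_scope.
Local Open Scope ring_scope.

Section ElementaryDivisors.
Context {F : fieldType} {n : nat}.
Implicit Types (M : 'M[F]_n) (P : 'M[{poly F}]_n).

(* Determinantal divisor: gcd of all k x k minors.  Letting the index maps range
   over all functions only adds zero minors and sign changes, which do not
   affect the gcd; for k = 0 the value is (an associate of) 1. *)
Definition determinantal_divisor (k : nat) P : {poly F} :=
  \big[@gcdp F/0]_(f : {ffun 'I_k -> 'I_n})
    \big[@gcdp F/0]_(g : {ffun 'I_k -> 'I_n}) \det (mxsub f g P).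

Definition invariant_factor (k : nat) P : {poly F} :=
  determinantal_divisor k.+1 P %/ determinantal_divisor k P.

(* ('X - a)^s is an elementary divisor of M, i.e. the exact power of 'X - a in
   some invariant factor of the characteristic matrix 'X - M. *)
Definition elementary_divisor M (a : F) (s : nat) : Prop :=
  (0 < s)%N /\
  exists2 k, (k < n)%N & mup a (invariant_factor k (char_poly_mx M)) = s.

End ElementaryDivisors.

Section Notions.
Context {R : realType}.

(* The integral of g from a to b, with the usual sign change when b < a. *)
Definition oint (a b : R) (g : R -> R) : R :=
  if a <= b then \int[lebesgue_measure]_(x in `[a, b]) g x
  else - \int[lebesgue_measure]_(x in `[b, a]) g x.

Definition lin_indep_on (J : set R) (m : nat) (alpha : 'I_m -> R -> R) : Prop :=
  forall c : 'I_m -> R,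
    (forall t, J t -> \sum_j c j * alpha j t = 0) -> forall j, c j = 0.

Context {n : nat}.

Definition dot (nu x : 'cV[R]_n) : R := \sum_i nu i 0 * x i 0.

Definition arcwise_connected (X : set 'cV[R]_n) : Prop :=
  forall x y, X x -> X y ->
    exists g : R -> 'cV[R]_n,
      [/\ {within `[0, 1], continuous g}, g 0 = x, g 1 = y &
          forall t, 0 <= t <= 1 -> X (g t)].

Definition domain (X : set 'cV[R]_n) : Prop := open X /\ arcwise_connected X.

(* \sum_i (A x)_i d/dx_i *)
Definition lin_op (A : 'M[R]_n) (F : 'cV[R]_n -> R) (x : 'cV[R]_n) : R :=
  \sum_i (A *m x) i 0 * 'D_(delta_mx i 0) F x.

(* F is a first integral of dx/dt = V(t, x) on J x X, where J is an interval and
   X is open: F has continuous partial derivatives Ft, Fx on J x X, and they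
   satisfy the defining identity.  The derivative in t is taken relative to J,
   hence one-sided at an end point belonging to J and ordinary elsewhere.  Only
   the values of F on J x X matter. *)
Definition first_integral (J : set R) (X : set 'cV[R]_n)
    (V : R -> 'cV[R]_n -> 'cV[R]_n) (F : R -> 'cV[R]_n -> R) : Prop :=
  exists (Ft : R -> 'cV[R]_n -> R) (Fx : 'I_n -> R -> 'cV[R]_n -> R),
    [/\ {within J `*` X, continuous (fun p : R * 'cV[R]_n => Ft p.1 p.2)},
        forall i,
          {within J `*` X, continuous (fun p : R * 'cV[R]_n => Fx i p.1 p.2)},
        forall t x, J t -> X x ->
          h^-1 * (F (t + h) x - F t x)
            @[h --> within [set h | J (t + h)] 0^'] --> Ft t x,
        forall t x, J t -> X x ->
          forall i, is_derive x (delta_mx i 0) (F t) (Fx i t x) &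
        forall t x, J t -> X x ->
          Ft t x + \sum_i V t x i 0 * Fx i t x = 0].

(* The autonomous case: a function of x alone and the system dx/dt = A x, seen
   as time-independent data on R x X. *)
Definition autonomous_first_integral (X : set 'cV[R]_n) (A : 'M[R]_n)
    (F : 'cV[R]_n -> R) : Prop :=
  first_integral setT X (fun _ x => A *m x) (fun _ => F).

Definition constant_on (X : set 'cV[R]_n) (F : 'cV[R]_n -> R) : Prop :=
  exists c, forall x, X x -> F x = c.

End Notions.

(* Main.v *)
Require Import Defs.
From mathcomp Require Import ring lra zify.

(** Write [L_k = nu^k x], let [a] be the derivation along [A_zeta] and [b] the one
    along another [A_j], and put [M_k = b L_k].  Since the matrices commute,
    [a L_k = lambda L_k + k L_(k-1)] and [a M_k = lambda M_k + k M_(k-1)]; applying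
    [a] to the functional system gives [a Psi_1 = 1] and [a Psi_k = 0] for [k > 1],
    and applying it to the [b]-derivative of the functional system gives
    [a (b Psi_k) = 0].  Hence [b Psi_k] is a first integral of dx/dt = A_zeta x,
    and it is constant by (iii).

    Knowing these constants, the functional system yields
    [b L_k = lambda^j L_k + sum_i C(k, i) mu^j_i L_(k-i)].  So, along the
    nonhomogeneous system, [G_k = L_k phi - C_k] has derivative
    [sum_i C(k, i) mu_i G_(k-i)], and the [K] are exactly the coefficients for
    which the triangular combinations [F_k = G_k - sum_i K^k_i F_i] have
    derivative zero. *)

Local Open Scope classical_set_scope.
Local Open Scope ring_scope.

Set Implicit Arguments.
Unset Strict Implicit.

(** * Difference quotients along a filter tending to 0 *)

Section DifferenceQuotients.
Context {R : realType} (G : set_system R) {FG : Filter G}.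
Context (G0 : id @ G --> (0 : R)) (Gn0 : \forall h \near G, h != 0).
Implicit Types (u v : R -> R) (a b c d : R).

(** With [G] left abstract, the same rules serve the time derivative relative to [J], one-sided at
    end points, and the directional derivatives in [x]. *)
Definition quot_cvg u a d := h^-1 * (u h - a) @[h --> G] --> d.

Lemma quot_cvg_cvg u a d : quot_cvg u a d -> u @ G --> a.
Proof.
move=> ud.
have : h * (h^-1 * (u h - a)) + a @[h --> G] --> 0 * d + a.
  by apply: cvgD; [apply: cvgM|apply: cvg_cst].
rewrite mul0r add0r; apply: cvg_trans; apply: near_eq_cvg; near=> h.
by rewrite mulrA mulfV ?mul1r ?subrK//; near: h.
Unshelve. all: by end_near. Qed.

Lemma quot_cvgD u v a b c d :
  quot_cvg u a c -> quot_cvg v b d -> quot_cvg (u \+ v) (a + b) (c + d).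
Proof.
move=> uc vd; rewrite /quot_cvg.
under eq_fun do rewrite /= opprD addrACA mulrDr.
exact: cvgD.
Qed.

Lemma quot_cvgM u v a b c d : quot_cvg u a c -> quot_cvg v b d ->
  quot_cvg (u \* v) (a * b) (c * b + a * d).
Proof.
move=> uc vd; rewrite /quot_cvg.
have E h : h^-1 * ((u \* v) h - a * b) =
    h^-1 * (u h - a) * v h + a * (h^-1 * (v h - b)) by rewrite /=; ring.
under eq_fun do rewrite E.
apply: cvgD; apply: cvgM => //; last exact: cvg_cst.
exact: quot_cvg_cvg vd.
Qed.

(** The increment [u h - a] may vanish, so the slope of [g] is extended by [g'] at 0. This extension
    [q] is continuous at 0, and the quotient of [g \o u] is [q (u h - a)] times that of [u] for
    every [h]. *)
Lemma quot_cvg_comp (g : R -> R) u a d g' :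
  is_derive a 1 g g' -> quot_cvg u a d -> quot_cvg (g \o u) (g a) (g' * d).
Proof.
move=> [dg eg] ud.
pose q k := if k == 0 then g' else k^-1 * (g (k + a) - g a).
have qc : q k @[k --> 0] --> q 0.
  apply/continuous_withinNx; rewrite {2}/q eqxx -eg.
  apply: cvg_trans dg; apply: near_eq_cvg; near=> k.
  have k0 : k != 0 by near: k; exact: nbhs_dnbhs_neq.
  by rewrite /q (negPf k0) /= /GRing.scale /= mulr1.
have u0 : u h - a @[h --> G] --> 0.
  by rewrite -(subrr a); apply: cvgB; [apply: quot_cvg_cvg ud|apply: cvg_cst].
have E h : h^-1 * ((g \o u) h - g a) = q (u h - a) * (h^-1 * (u h - a)).
  rewrite /q /=; case: (eqVneq (u h - a) 0) => [/eqP|N].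
    by rewrite subr_eq0 => /eqP ->; rewrite !subrr !mulr0.
  by rewrite subrK [_ * (_ - a)]mulrC mulrACA mulVf ?mul1r // mulrC.
rewrite /quot_cvg; under eq_fun do rewrite E.
apply: cvgM => //.
have := @cvg_comp _ _ _ (fun h => u h - a) q G (nbhs 0) (nbhs (q 0)) u0 qc.
by rewrite {2}/q eqxx.
Unshelve. all: by end_near. Qed.

End DifferenceQuotients.

(** * Oriented integrals and the fundamental theorem of calculus relative to an interval *)

Section OrientedIntegral.
Context {R : realType} (J : set R) (HJ : is_interval J).
Implicit Types (a b c e t : R) (k : R -> R).
Local Notation mu := (@lebesgue_measure R).

Lemma itv_subset_interval a b : J a -> J b -> `[a, b] `<=` J.
Proof.
by move=> Ja Jb x /=; rewrite in_itv /= => axb; apply: HJ Ja Jb _ axb.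
Qed.

Lemma within_integrable k a b : {within J, continuous k} -> J a -> J b ->
  mu.-integrable `[a, b] (EFin \o k).
Proof.
move=> kc Ja Jb; apply: continuous_compact_integrable.
  exact: segment_compact.
by apply: continuous_subspaceW kc; apply: itv_subset_interval.
Qed.

Lemma oint_refl k a : oint a a k = 0.
Proof. by rewrite /oint lexx set_itv1 Rintegral_set1. Qed.

Lemma oint_sym k a b : oint b a k = - oint a b k.
Proof.
case: (ltgtP a b) => [ab|ba|->]; last by rewrite oint_refl oppr0.
  by rewrite /oint leNgt ab /= ltW.
by rewrite /oint (ltW ba) leNgt ba /= opprK.
Qed.

Let oint_catle k a b c : {within J, continuous k} ->
  J a -> J c -> a <= b -> b <= c -> oint a b k + oint b c k = oint a c k.
Proof.
move=> kc Ja Jc ab bc; rewrite /oint ab bc (le_trans ab bc).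
have Jb : J b by apply: HJ Ja Jc _ _; rewrite ab.
apply/esym/eqP; rewrite addrC -subr_eq; apply/eqP.
(* Removing the point [b] changes the integral over [[b, c]] by a null set only and makes the two
   pieces of [[a, c]] disjoint. *)
rewrite -(@Rintegral_itv_obnd_cbnd _ b); last first.
  refine (@integrableS _ _ R mu `[b, c] `]b, c] (EFin \o k) _ _ _ _) => //;
    last first.
    exact: within_integrable.
  by apply: subset_itvr; rewrite bnd_simp.
by apply: Rintegral_itvB; rewrite ?bnd_simp //; exact: within_integrable.
Qed.

Lemma oint_cat k a b c : {within J, continuous k} ->
  J a -> J b -> J c -> oint a b k + oint b c k = oint a c k.
Proof.
move=> kc Ja Jb Jc.
have H x y z : J x -> J z -> x <= y -> y <= z -> _ := @oint_catle k x y z kc.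
have := (oint_sym k a b, oint_sym k b c, oint_sym k a c).
case=> -[Eab Ebc] Eac.
case: (leP a b) => [|/ltW] ab; case: (leP b c) => [|/ltW] bc.
- exact: H.
- case: (leP a c) => [|/ltW] ac.
    by rewrite -(H a c b) // Ebc; ring.
  by have := H c a b Jc Jb ac ab; rewrite Ebc Eac; lra.
- case: (leP a c) => [|/ltW] ac.
    by rewrite -(H b a c) // Eab; ring.
  by have := H b c a Jb Ja bc ac; rewrite Eab Eac; lra.
- by have := H c b a Jc Ja bc ab; rewrite Ebc Eab Eac; lra.
Qed.

(** Both constants are rewritten as integrals over [[a, b]], which reduces the bound to monotonicity
    of the integral of [|k x - c|]. *)
Lemma oint_dist k a b c e : {within J, continuous k} -> J a -> J b -> a <= b ->
  (forall x, a <= x <= b -> `|k x - c| <= e) ->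
  `|oint a b k - (b - a) * c| <= e * `|b - a|.
Proof.
move=> kc Ja Jb ab ke; have ik := within_integrable kc Ja Jb.
have icst r : mu.-integrable `[a, b] (EFin \o cst r).
  apply: continuous_compact_integrable; first exact: segment_compact.
  by move=> x; exact: cvg_cst.
have Ecst r : \int[mu]_(x in `[a, b]) r = r * (b - a).
  rewrite Rintegral_cst //= [mu _]lebesgue_measure_itv /= lte_fin.
  by move: ab; rewrite le_eqVlt => /predU1P[->|->] //=; rewrite ltxx subrr.
rewrite /oint ab [(b - a) * c]mulrC [`|b - a|]ger0_norm ?subr_ge0 // -!Ecst.
rewrite -(RintegralB _ ik (icst c)) //.
have ikc : mu.-integrable `[a, b] (EFin \o (fun x => k x - c)).
  exact: (integrableB _ ik (icst c)).
apply: (le_trans (le_normr_Rintegral _ ikc)) => //.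
apply: (le_Rintegral _ (integrable_norm ikc) (icst e)) => //=.
Qed.

(** The increment is the integral between [t] and [t + h], a segment contained in [J] by convexity.
    There [k] is within [e] of [k t], so [oint_dist] applies even when [t] is an end point of [J].
    The sign of [h] decides the orientation. *)
Lemma oint_derive k t0 t : {within J, continuous k} -> J t0 -> J t ->
  quot_cvg (within [set h | J (t + h)] 0^') (fun h => oint t0 (t + h) k)
    (oint t0 t k) (k t).
Proof.
move=> kc Jt0 Jt; apply/cvgrPdist_le => e e0.
have /subspace_continuousP/(_ t Jt)/cvgrPdist_le/(_ e e0) := kc.
rewrite !near_withinE !near_simpl => -[d /= d0 kd].
near=> h => /= h0 Jth;
rewrite -(oint_cat kc Jt0 Jt Jth) [oint t0 t k + _]addrC addrK.
have hd : `|h| < d.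
  near: h; exists d => //= x /=.
  by rewrite sub0r normrN.
have ke x : J x -> `|t - x| <= `|h| -> `|k x - k t| <= e.
  by move=> Jx th; rewrite distrC; apply: kd => //=; exact: le_lt_trans hd.
have {ke} : `|oint t (t + h) k - h * k t| <= e * `|h|.
  have [h_ge0|h_lt0] := leP 0 h.
    have := @oint_dist k t (t + h) (k t) e kc Jt Jth.
    rewrite addrAC subrr add0r lerDl; apply => // x /andP[tx xth].
    apply: ke; first by apply: HJ Jt Jth _ _; rewrite tx.
    by rewrite distrC !ger0_norm ?subr_ge0 // lerBlDl.
  have := @oint_dist k (t + h) t (k t) e kc Jth Jt.
  have -> : t - (t + h) = - h by ring.
  rewrite oint_sym mulNr -opprD !normrN => E; apply: E; rewrite ?gerDl ?ltW //.
  move=> x /andP[thx xt]; apply: ke; first by apply: HJ Jth Jt _ _; rewrite thx.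
  by rewrite ger0_norm ?subr_ge0 // ltr0_norm // lerBlDl addrC -lerBlDl opprK.
have -> : k t - h^-1 * oint t (t + h) k = - (h^-1 * (oint t (t + h) k - h * k t)).
  by field.
by rewrite normrN normrM normfV ler_pdivrMl ?normr_gt0 // [`|h| * e]mulrC.
Unshelve. all: by end_near. Qed.

End OrientedIntegral.

(** * Derivatives along a vector field on J x X *)

Section TotalDerivative.
Context {R : realType} {n : nat} (J : set R) (X : set 'cV[R]_n) (oX : open X).
Implicit Types (F D : R -> 'cV[R]_n -> R) (V : R -> 'cV[R]_n -> 'cV[R]_n).
Implicit Type (g : R -> R).

(** This pointwise form of relative continuity lets the limit rules for sums, products and
    compositions apply directly. *)
Definition jcontinuous F := forall p, (J `*` X) p ->
  F q.1 q.2 @[q --> within (J `*` X) (nbhs p)] --> F p.1 p.2.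

Lemma jcontinuousP F :
  {within J `*` X, continuous (fun p : R * 'cV[R]_n => F p.1 p.2)} <->
  jcontinuous F.
Proof. exact: subspace_continuousP. Qed.

Definition dtime t := within [set h | J (t + h)] 0^'.

#[local] Instance dtime_filter t : Filter (dtime t).
Proof. exact: within_filter. Qed.

Definition time_derive g (g' : R -> R) :=
  forall t, J t -> quot_cvg (dtime t) (fun h => g (t + h)) (g t) (g' t).

(* Continuity of [F] follows from the other clauses by the mean value theorem;
   requiring it makes the closure properties below direct. *)
Definition jet F Ft (Fx : 'I_n -> R -> 'cV[R]_n -> R) :=
  [/\ jcontinuous F, jcontinuous Ft, forall i, jcontinuous (Fx i),
      forall x, X x -> time_derive (F ^~ x) (Ft ^~ x) &
      forall t x, J t -> X x -> forall i,
        is_derive x (delta_mx i 0) (F t) (Fx i t x)].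

(** The partial derivatives are existentially hidden, so the rules below only track the derivative
    [D] along [V], whose values matter on [J x X] alone. *)
Definition derives V F D := exists Ft Fx, jet F Ft Fx /\
  forall t x, J t -> X x -> D t x = Ft t x + \sum_i V t x i 0 * Fx i t x.

Lemma derives_first_integral V F D : derives V F D ->
  (forall t x, J t -> X x -> D t x = 0) -> first_integral J X V F.
Proof.
move=> [Ft [Fx [[_ ct cx dt dx] DE]]] D0; exists Ft, Fx; split=> //.
- exact/jcontinuousP.
- by move=> i; exact/jcontinuousP.
- by move=> t x Jt Xx; exact: (dt x Xx t Jt).
- by move=> t x Jt Xx; rewrite -DE ?D0.
Qed.

Lemma dtime_id t : id @ dtime t --> (0 : R).
Proof.
by move=> A A0; apply: cvg_within; apply: cvg_within.
Qed.

Lemma dtime_neq0 t : \forall h \near dtime t, h != 0.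
Proof. by rewrite !near_withinE; near=> h => /= + _. Unshelve. all: by end_near. Qed.

Lemma time_derive_cvg g g' t : time_derive g g' -> J t ->
  g @ within J (nbhs t) --> g t.
Proof.
move=> dg Jt.
have /cvgrPdist_lt gc : g (t + h) @[h --> dtime t] --> g t.
  refine (quot_cvg_cvg (@dtime_id t) (@dtime_neq0 t) (dg t Jt)).
apply/cvgrPdist_lt => e e0; move/(_ e e0): gc.
rewrite !near_withinE => -[d /= d0 gd]; exists d => //= x /= tx Jx.
(* The filter [dtime t] omits [h = 0], so the point [t] itself is treated apart. *)
have [->|nxt] := eqVneq x t; first by rewrite subrr normr0.
have := gd (x - t); rewrite /= sub0r opprB subrKC; apply => //.
by rewrite subr_eq0.
Qed.

Lemma is_derive_quot (f : 'cV[R]_n -> R) x v d :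
  is_derive x v f d <-> quot_cvg 0^' (fun h => f (h *: v + x)) (f x) d.
Proof.
split=> [[df <-]|df]; first exact: df.
by split; [apply/cvg_ex; exists d|apply: cvg_lim].
Qed.

Let d0id : id @ 0^' --> (0 : R).
Proof. by move=> A A0; apply: cvg_within. Qed.
Let d0neq : \forall h \near (0 : R)^', h != 0 := nbhs_dnbhs_neq 0.

Lemma jcontinuousD F G : jcontinuous F -> jcontinuous G ->
  jcontinuous (fun t x => F t x + G t x).
Proof. by move=> cF cG p Sp; apply: cvgD; [apply: cF|apply: cG]. Qed.

Lemma jcontinuousM F G : jcontinuous F -> jcontinuous G ->
  jcontinuous (fun t x => F t x * G t x).
Proof. by move=> cF cG p Sp; apply: cvgM; [apply: cF|apply: cG]. Qed.

Lemma jcontinuous_comp g F : jcontinuous F ->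
  (forall t x, J t -> X x -> {for F t x, continuous g}) ->
  jcontinuous (fun t x => g (F t x)).
Proof.
move=> cF cg p Sp; have [Jp Xp] := Sp.
exact: (@cvg_comp _ _ _ (fun q => F q.1 q.2) g _ _ _ (cF p Sp) (cg _ _ Jp Xp)).
Qed.

Lemma derivesD V F G D E : derives V F D -> derives V G E ->
  derives V (fun t x => F t x + G t x) (fun t x => D t x + E t x).
Proof.
move=> [Ft [Fx [[c ct cx dt dx] DE]]] [Gt [Gx [[c' ct' cx' dt' dx'] DE']]].
exists (fun t x => Ft t x + Gt t x), (fun i t x => Fx i t x + Gx i t x); split.
  split=> [|||x Xx t Jt|t x Jt Xx i].
  - exact: jcontinuousD.
  - exact: jcontinuousD.
  - by move=> i; apply: jcontinuousD.
  - by apply: quot_cvgD; [apply: dt|apply: dt'].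
  - by apply: is_deriveD; [apply: dx|apply: dx'].
move=> t x Jt Xx; rewrite DE // DE' // addrACA -big_split /=; congr (_ + _).
by apply: eq_bigr => i _; rewrite mulrDr.
Qed.

Lemma derivesM V F G D E : derives V F D -> derives V G E ->
  derives V (fun t x => F t x * G t x) (fun t x => D t x * G t x + F t x * E t x).
Proof.
move=> [Ft [Fx [[c ct cx dt dx] DE]]] [Gt [Gx [[c' ct' cx' dt' dx'] DE']]].
exists (fun t x => Ft t x * G t x + F t x * Gt t x),
  (fun i t x => Fx i t x * G t x + F t x * Gx i t x); split.
  split=> [|||x Xx t Jt|t x Jt Xx i].
  - exact: jcontinuousM.
  - by apply: jcontinuousD; apply: jcontinuousM.
  - by move=> i; apply: jcontinuousD; apply: jcontinuousM.
  - apply: quot_cvgM; [exact: dtime_id|exact: dtime_neq0|exact: dt|exact: dt'].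
  - apply/is_derive_quot; apply: quot_cvgM; [exact: d0id|exact: d0neq|..].
      by apply/is_derive_quot; apply: dx.
    by apply/is_derive_quot; apply: dx'.
move=> t x Jt Xx; rewrite DE // DE' // mulrDl mulrDr addrACA; congr (_ + _).
rewrite mulr_suml mulr_sumr -big_split; apply: eq_bigr => i _ /=; ring.
Qed.

Lemma derives_comp V g g' F D : derives V F D ->
  (forall t x, J t -> X x -> is_derive (F t x) 1 g (g' (F t x))) ->
  (forall t x, J t -> X x -> {for F t x, continuous g'}) ->
  derives V (fun t x => g (F t x)) (fun t x => g' (F t x) * D t x).
Proof.
move=> [Ft [Fx [[c ct cx dt dx] DE]]] dg cg'.
have cg t x : J t -> X x -> {for F t x, continuous g}.
  move=> Jt Xx; have [+ _] := dg t x Jt Xx.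
  by move=> /derivable1_diffP/differentiable_continuous.
exists (fun t x => g' (F t x) * Ft t x), (fun i t x => g' (F t x) * Fx i t x).
split.
  split=> [|||x Xx t Jt|t x Jt Xx i].
  - exact: jcontinuous_comp.
  - by apply: jcontinuousM => //; apply: jcontinuous_comp.
  - by move=> i; apply: jcontinuousM => //; apply: jcontinuous_comp.
  - apply: (quot_cvg_comp (@dtime_id t) (@dtime_neq0 t)).
      exact: dg.
    exact: dt.
  - apply/is_derive_quot; apply: (quot_cvg_comp (@d0id) d0neq); first exact: dg.
    by apply/is_derive_quot; apply: dx.
move=> t x Jt Xx; rewrite DE // mulrDr mulr_sumr; congr (_ + _).
by apply: eq_bigr => i _; rewrite mulrCA.
Qed.

Lemma derives_time V g g' : time_derive g g' -> {within J, continuous g'} ->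
  derives V (fun t _ => g t) (fun t _ => g' t).
Proof.
move=> dg /subspace_continuousP cg'.
(* Projecting to the time coordinate sends the relative filter on [J x X] to the one on [J], which
   transfers continuity of functions of [t] alone. *)
have fst_within (p : R * 'cV[R]_n) :
    q.1 @[q --> within (J `*` X) (nbhs p)] --> within J (nbhs p.1).
  case: p => t x A /= tA.
  have : nbhs (t, x) (fst @^-1` [set u | J u -> A u]) by apply: cvg_fst.
  by apply: filterS => q JA [Jq _]; exact: JA.
exists (fun t _ => g' t), (fun _ _ _ => 0); split; last first.
  by move=> t x _ _; rewrite big1 ?addr0 // => i _; rewrite mulr0.
split=> //.
- move=> p [Jp _];
  exact: (@cvg_comp _ _ _ _ g _ _ _ (fst_within p) (time_derive_cvg dg Jp)).
- move=> p [Jp _]; exact: (@cvg_comp _ _ _ _ g' _ _ _ (fst_within p) (cg' _ Jp)).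
- by move=> i p _; apply: cvg_cst.
- by move=> t x _ _ i; apply: is_derive_cst.
Qed.

Lemma derives_dot V nu : derives V (fun _ x => dot nu x) (fun t x => dot nu (V t x)).
Proof.
exists (fun _ _ => 0), (fun i _ _ => nu i 0); split; last first.
  by move=> t x _ _; rewrite add0r /dot; apply: eq_bigr => i _; rewrite mulrC.
split.
- move=> p _; apply: cvg_big => [|i _]; first exact: add_continuous.
  apply: cvgM; first exact: cvg_cst.
  apply: cvg_within_filter.
  exact: (@cvg_comp _ _ _ snd (fun y : 'cV[R]_n => y i 0) _ _ _ cvg_snd
    (@coord_continuous _ _ _ i 0 p.2)).
- by move=> p _; apply: cvg_cst.
- by move=> i p _; apply: cvg_cst.
- move=> x _ t _; rewrite /quot_cvg.
  by under eq_fun do rewrite subrr mulr0; apply: cvg_cst.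
move=> t x _ _ i; apply/is_derive_quot; rewrite /quot_cvg.
apply: cvg_near_cst; near=> h.
have -> : dot nu (h *: delta_mx i 0 + x) = h * nu i 0 + dot nu x.
  rewrite /dot (bigD1 i) //= [in RHS](bigD1 i) //= !mxE !eqxx mulr1 mulrDr.
  rewrite -addrA; congr (_ + (_ + _)); first by rewrite mulrC.
  by apply: eq_bigr => j /negPf ij; rewrite !mxE ij mulr0 add0r.
by rewrite addrK mulKf //; near: h; exact: nbhs_dnbhs_neq.
Unshelve. all: by end_near. Qed.

(** Quotients in [t] only see times in [J]. Quotients in [x] see a full neighbourhood, on which the
    functions agree because [X] is open. *)
Lemma derives_ext V F G D E : derives V F D ->
  (forall t x, J t -> X x -> F t x = G t x) ->
  (forall t x, J t -> X x -> D t x = E t x) -> derives V G E.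
Proof.
move=> [Ft [Fx [[c ct cx dt dx] DE]]] FG EE; exists Ft, Fx; split; last first.
  by move=> t x Jt Xx; rewrite -EE // DE.
split=> //.
- move=> p Sp; have [Jp Xp] := Sp; rewrite -FG //.
  apply: cvg_trans (c p Sp); apply: fmap_within_eq => q /set_mem[Jq Xq].
  by rewrite (FG _ _ Jq Xq).
- move=> x Xx t Jt; rewrite /quot_cvg -FG //.
  apply: cvg_trans (dt x Xx t Jt); apply: fmap_within_eq => h /set_mem /= Jth.
  by rewrite (FG _ _ Jth Xx).
- move=> t x Jt Xx i; apply: near_eq_is_derive (dx t x Jt Xx i).
  by have := open_nbhs_nbhs (conj oX Xx); apply: filterS => y; exact: FG.
Qed.

End TotalDerivative.

(** * Linearity of the derivative along a field *)

Section DerivesLinear.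
Context {R : realType} {n : nat} (J : set R) (X : set 'cV[R]_n) (oX : open X).
Implicit Types (F D : R -> 'cV[R]_n -> R) (V : R -> 'cV[R]_n -> 'cV[R]_n).

Lemma derives_cst V c : derives J X V (fun _ _ => c) (fun _ _ => 0).
Proof.
apply: (@derives_time _ _ J X V (fun=> c) (fun=> 0)) => [t _|x].
  rewrite /quot_cvg; under eq_fun do rewrite subrr mulr0.
  exact: cvg_cst.
exact: cvg_cst.
Qed.

Lemma derivesZ V c F D : derives J X V F D ->
  derives J X V (fun t x => c * F t x) (fun t x => c * D t x).
Proof.
move=> dF; apply: (derives_ext oX (derivesM (derives_cst V c) dF)) => // t x _ _.
by rewrite mul0r add0r.
Qed.

Lemma derivesB V F G D E : derives J X V F D -> derives J X V G E ->
  derives J X V (fun t x => F t x - G t x) (fun t x => D t x - E t x).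
Proof.
move=> dF /(derivesZ (-1)) dG.
by apply: (derives_ext oX (derivesD dF dG)) => t x _ _; rewrite mulN1r.
Qed.

Lemma derives_sum V (I : Type) (r : seq I) (P : pred I)
    (F D : I -> R -> 'cV[R]_n -> R) :
  (forall i, P i -> derives J X V (F i) (D i)) ->
  derives J X V (fun t x => \sum_(i <- r | P i) F i t x)
    (fun t x => \sum_(i <- r | P i) D i t x).
Proof.
move=> dF; elim: r => [|i r IH].
  by apply: (derives_ext oX (derives_cst V 0)) => t x _ _; rewrite big_nil.
have [Pi|nPi] := boolP (P i); last first.
  by apply: (derives_ext oX IH) => t x _ _; rewrite big_cons (negPf nPi).
by apply: (derives_ext oX (derivesD (dF i Pi) IH)) => t x _ _;
  rewrite big_cons Pi.
Qed.

End DerivesLinear.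

(** * Time-independent functions and linear fields *)

Section Autonomous.
Context {R : realType} {n : nat} (X : set 'cV[R]_n) (oX : open X).
Implicit Types (F G : 'cV[R]_n -> R) (A : 'M[R]_n).

Definition C1_on F := exists Ft Fx, jet setT X (fun _ => F) Ft Fx.

Lemma derives_C1 V F D : derives setT X V (fun _ => F) D -> C1_on F.
Proof. by move=> [Ft [Fx [jF _]]]; exists Ft, Fx. Qed.

Lemma derives_lin_op A F D t x :
  derives setT X (fun _ x => A *m x) (fun _ => F) D -> X x -> D t x = lin_op A F x.
Proof.
move=> [Ft [Fx [[_ _ _ dt dx] DE]]] Xx; rewrite DE //.
suff -> : Ft t x = 0.
  by rewrite add0r; apply: eq_bigr => i _; have [_ ->] := dx t x I Xx i.
have := dt x Xx t I; rewrite /quot_cvg /dtime.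
under eq_fun do rewrite subrr mulr0.
(* For [J = setT] the restriction in [dtime] is vacuous, so [Ft t x] is the limit at 0 of a zero
   quotient. *)
move=> F0; have : (fun=> 0) @ (0 : R)^' --> Ft t x.
  move=> B /F0; rewrite !near_simpl /= => -[d d0 dB]; exists d => // h hd h0.
  exact: dB hd h0 I.
by move/(cvg_lim (@norm_hausdorff _ _)) => <-; exact: lim_cst.
Qed.

Lemma C1_derives A F : C1_on F ->
  derives setT X (fun _ x => A *m x) (fun _ => F) (fun _ => lin_op A F).
Proof.
move=> [Ft [Fx jF]].
have dF : derives setT X (fun _ x => A *m x) (fun _ => F)
    (fun t x => Ft t x + \sum_i (A *m x) i 0 * Fx i t x) by exists Ft, Fx.
by apply: (derives_ext oX dF) => // t x _ Xx; rewrite (derives_lin_op t dF).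
Qed.

(** This allows a functional identity valid on [X] to be differentiated along [A], each side by its
    own rules. *)
Lemma derives_unique A F G D E t x :
  derives setT X (fun _ x => A *m x) (fun _ => F) D ->
  derives setT X (fun _ x => A *m x) (fun _ => G) E ->
  (forall y, X y -> F y = G y) -> X x -> D t x = E t x.
Proof.
move=> dF dG FG Xx; rewrite (derives_lin_op t dG Xx); apply: derives_lin_op => //.
by apply: (derives_ext oX dF) => // ? y _; exact: FG.
Qed.

End Autonomous.

(** * Algebra of binomial convolutions *)

Section BinomialConvolutions.

(** For [a + b <= k] both sides are the trinomial coefficient k! / (a! b! (k - a - b)!); otherwise
    both vanish. *)
Lemma mul_bin_sub k a b : ('C(k, a) * 'C(k - a, b) = 'C(k, b) * 'C(k - b, a))%N.
Proof.
have [abk|kab] := leqP (a + b) k; last first.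
  have [ka|ak] := ltnP k a; have [kb|bk] := ltnP k b;
    by rewrite ?(bin_small ka) ?(bin_small kb) ?mul0n ?[RHS]bin_small //
      ?['C(k - a, b)]bin_small ?['C(k - b, a)]bin_small ?muln0 //; lia.
have Eab : (k - a - b = k - b - a)%N by lia.
apply/eqP; rewrite -(eqn_pmul2r (fact_gt0 a)) -(eqn_pmul2r (fact_gt0 b)).
rewrite -(eqn_pmul2r (fact_gt0 (k - a - b))); apply/eqP.
have Ba : (a <= k)%N by lia.
have Bb : (b <= k)%N by lia.
have Bab : (b <= k - a)%N by lia.
have Bba : (a <= k - b)%N by lia.
have := (bin_fact Ba, bin_fact Bb, bin_fact Bab, bin_fact Bba).
rewrite -Eab => -[[[Ea Eb] Ec] Ed].
transitivity k`!; first by rewrite -Ea -Ec; ring.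
by rewrite -Eb -Ed; ring.
Qed.

Context {R : comPzRingType}.
Implicit Types (L M P T mu : nat -> R) (lam : R).

Lemma big_ord_widen0 m k (T : nat -> R) : (m <= k)%N ->
  (forall i, (m <= i)%N -> T i = 0) -> \sum_(i < m) T i = \sum_(i < k) T i.
Proof.
move=> mk T0; rewrite (big_ord_widen k T mk) big_mkcond; apply: eq_bigr => i _.
by case: ltnP => // /T0.
Qed.

(* In exponential generating functions the hypotheses read L' = P' L and
   N' = mu' L + P' N, so that (N / L)' = mu' and N = (lam + mu) L. *)
Lemma convolution_eigen (s : nat) L P N mu lam :
  N 0%N = lam * L 0%N ->
  (forall k, (k.+1 < s)%N ->
     L k.+1 = \sum_(i < k.+1) 'C(k, i)%:R * P i.+1 * L (k - i)%N) ->
  (forall k, (k.+1 < s)%N -> N k.+1 =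
     \sum_(i < k.+1) 'C(k, i)%:R *
       (mu i.+1 * L (k - i)%N + P i.+1 * N (k - i)%N)) ->
  forall k, (k < s)%N ->
  N k = lam * L k + \sum_(i < k) 'C(k, i.+1)%:R * mu i.+1 * L (k - i.+1)%N.
Proof.
move=> N0 EL EN; elim/ltn_ind => -[_ _|k IH ks].
  by rewrite big_ord0 addr0.
(* The induction hypothesis is substituted for each [N (k - i)]. The inner sums are padded to length
   [k.+1], the added binomials being zero, so that the summations can be exchanged. *)
have -> : N k.+1 = lam * L k.+1
   + \sum_(i < k.+1) 'C(k, i)%:R * mu i.+1 * L (k - i)%N
   + \sum_(i < k.+1) \sum_(j < k.+1)
       'C(k, i)%:R * 'C(k - i, j.+1)%:R * P i.+1 * mu j.+1 * L (k - j.+1 - i)%N.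
  rewrite EN // EL // mulr_sumr -!big_split /=; apply: eq_bigr => i _.
  rewrite IH; [|lia..].
  have -> : \sum_(j < k.+1) 'C(k, i)%:R * 'C(k - i, j.+1)%:R * P i.+1 * mu j.+1
       * L (k - j.+1 - i)%N = 'C(k, i)%:R * P i.+1 *
      \sum_(j < k - i) 'C(k - i, j.+1)%:R * mu j.+1 * L (k - i - j.+1)%N.
    rewrite (@big_ord_widen0 _ k.+1
      (fun j => 'C(k - i, j.+1)%:R * mu j.+1 * L (k - i - j.+1)%N)).
    - by rewrite mulr_sumr; apply: eq_bigr => j _; rewrite subnAC; ring.
    - lia.
    - by move=> j jk; rewrite bin_small ?mul0r.
  ring.
rewrite -addrA; congr (_ + _); rewrite exchange_big /= -big_split /=.
(* Pascal's rule splits ['C(k.+1, j.+1)]. The part ['C(k, j)] is the single sum; the part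
   ['C(k, j.+1)] is the double sum once [L (k - j)] is expanded by its own recurrence. *)
apply: eq_bigr => j _; rewrite subSS binS natrD !mulrDl addrC; congr (_ + _).
have [jk|jk] := ltnP j k; last first.
  rewrite [X in _ = X%:R * _ * _]bin_small ?ltnS // !mul0r big1 // => i _.
  by rewrite ['C(k - i, j.+1)]bin_small ?mulr0 ?mul0r //; lia.
have -> : L (k - j)%N =
    \sum_(i < k.+1) 'C(k - j.+1, i)%:R * P i.+1 * L (k - j.+1 - i)%N.
  rewrite -(@big_ord_widen0 (k - j.+1).+1 k.+1
     (fun i => 'C(k - j.+1, i)%:R * P i.+1 * L (k - j.+1 - i)%N)).
  - by rewrite -EL ?subnSK //; lia.
  - lia.
  - by move=> i ik; rewrite bin_small ?mul0r.
rewrite mulr_sumr; apply: eq_bigr => i _.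
by rewrite -natrM mul_bin_sub natrM; ring.
Qed.

(** Since (k - i) C(k, i) = k C(k - 1, i), lowering the second index in every term lowers the index
    of the whole convolution. This is how the derivation along [A_zeta] acts when the second factors
    form a generalized eigenchain. *)
Lemma convolution_shift U (W : nat -> nat -> R) lam k :
  (forall l, (l <= k)%N -> U l.+1 = \sum_(i < l.+1) 'C(l, i)%:R * W i (l - i)%N) ->
  \sum_(i < k.+1) 'C(k, i)%:R *
    (lam * W i (k - i)%N + (k - i)%:R * W i (k - i).-1)
  = lam * U k.+1 + k%:R * U k.
Proof.
move=> EU; under eq_bigr do rewrite mulrDr.
rewrite big_split /= EU // mulr_sumr; congr (_ + _).
  by apply: eq_bigr => i _; ring.
(* Nothing is known about [U 0], but for [k = 0] its coefficient is zero. *)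
case: k EU => [|k] EU; first by rewrite big_ord1 subnn mul0r mulr0 mul0r.
rewrite EU // mulr_sumr big_ord_recr /= subnn mul0r mulr0 addr0.
apply: eq_bigr => i _; rewrite !mulrA -!natrM mulnC -mul_bin_down.
by rewrite subSn // -ltnS.
Qed.

(** The system is triangular in [y] with [L 0] on the diagonal, and [L 0] can be cancelled. *)
Lemma convolution_inj (N : nat) L (y : nat -> R) :
  (forall a, a * L 0%N = 0 -> a = 0) ->
  (forall k, (k < N)%N -> \sum_(i < k.+1) 'C(k, i)%:R * y i * L (k - i)%N = 0) ->
  forall k, (k < N)%N -> y k = 0.
Proof.
move=> L0 E; elim/ltn_ind => k IH kN; have := E k kN.
rewrite big_ord_recr /= binn mul1r subnn big1 ?add0r; first exact: L0.
by move=> i _; rewrite IH ?mulr0 ?mul0r //; have := ltn_ord i; lia.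
Qed.

Lemma convolution_delta k L :
  \sum_(i < k.+1) 'C(k, i)%:R * ((i : nat) == 0%N)%:R * L (k - i)%N = L k.
Proof.
rewrite big_ord_recl /= bin0 subn0 !mul1r big1 ?addr0 // => i _.
by rewrite mulr0 mul0r.
Qed.

(** The bracket on the right is the integrand defining [K k i]. Thus the derivative of [G k],
    rewritten through the [F i], has the derivatives of the [K k i] as coefficients. The double sums
    agree because [i < k - j.+1] and [j < k - i.+1] describe the same pairs. *)
Lemma convolution_triangular (G F mu : nat -> R) (K : nat -> nat -> R) k :
  (forall l, (l < k)%N -> G l = F l + \sum_(i < l) K l i * F i) ->
  \sum_(j < k) 'C(k, j.+1)%:R * mu j.+1 * G (k - j.+1)%N =
  \sum_(i < k) ('C(k, i)%:R * mu (k - i)%N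
     + \sum_(j < k - i.+1) 'C(k, j.+1)%:R * mu j.+1 * K (k - j.+1)%N i) * F i.
Proof.
move=> EG.
have {}EG (j : 'I_k) : _ := EG (k - j.+1)%N ltac:(have := ltn_ord j; lia).
under eq_bigr do rewrite EG mulrDr.
under [RHS]eq_bigr do rewrite mulrDl.
rewrite !big_split /=; congr (_ + _).
  rewrite (reindex_inj rev_ord_inj) /=; apply: eq_bigr => i _.
  have ik := ltn_ord i; rewrite subnSK // bin_sub; last lia.
  by rewrite subKn //; lia.
pose T i j := 'C(k, j.+1)%:R * mu j.+1 * K (k - j.+1)%N i * F i.
transitivity (\sum_(j < k) \sum_(i < k | (i < k - j.+1)%N) T i j).
  apply: eq_bigr => j _; rewrite mulr_sumr.
  rewrite -(big_ord_widen k (T^~ j)) ?leq_subr //.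
  by apply: eq_bigr => i _; rewrite /T mulrA.
transitivity (\sum_(i < k) \sum_(j < k | (j < k - i.+1)%N) T i j); last first.
  apply: eq_bigr => i _; rewrite mulr_suml.
  by rewrite -(big_ord_widen k (T i)) ?leq_subr.
rewrite (exchange_big_dep xpredT) //=; apply: eq_bigr => i _.
by apply: eq_bigl => j; lia.
Qed.

End BinomialConvolutions.

(** * The bilinear form [dot] *)

Section Dot.
Context {R : realType} {n : nat}.
Implicit Types (u v x y : 'cV[R]_n).

Lemma dot_mulmx u (A : 'M[R]_n) x : dot u (A *m x) = dot (A^T *m u) x.
Proof.
have dotE v y : dot v y = (v^T *m y) 0 0 :> R.
  by rewrite mxE; apply: eq_bigr => i _; rewrite mxE.
by rewrite !dotE trmx_mul trmxK mulmxA.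
Qed.

Lemma dotDl u v x : dot (u + v) x = dot u x + dot v x.
Proof. by rewrite -big_split; apply: eq_bigr => i _; rewrite mxE mulrDl. Qed.

Lemma dotDr u x y : dot u (x + y) = dot u x + dot u y.
Proof. by rewrite -big_split; apply: eq_bigr => i _; rewrite mxE mulrDr. Qed.

Lemma dotZl c u x : dot (c *: u) x = c * dot u x.
Proof. by rewrite /dot mulr_sumr; apply: eq_bigr => i _; rewrite mxE mulrA. Qed.

Lemma dotZr c u x : dot u (c *: x) = c * dot u x.
Proof. by rewrite /dot mulr_sumr; apply: eq_bigr => i _; rewrite mxE mulrCA. Qed.

Lemma dot_sumr (I : Type) (r : seq I) (P : pred I) u (x : I -> 'cV[R]_n) :
  dot u (\sum_(i <- r | P i) x i) = \sum_(i <- r | P i) dot u (x i).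
Proof.
apply: (big_morph (dot u)) => [y z|]; first exact: dotDr.
by rewrite -(scale0r 0) dotZr mul0r.
Qed.

End Dot.

(** * Closure properties of continuously differentiable functions on X *)

Section C1Closure.
Context {R : realType} {n : nat} (X : set 'cV[R]_n) (oX : open X).
Implicit Types (F G : 'cV[R]_n -> R).

(** [C1_on] mentions no field, so the rules for [derives] are borrowed with the zero matrix as
    field. *)
Lemma C1_ext F G : C1_on X F -> (forall x, X x -> F x = G x) -> C1_on X G.
Proof.
by move=> /(C1_derives oX 0) dF FG;
  apply: derives_C1 (derives_ext oX dF _ (fun _ _ _ _ => erefl)) => t x _; exact: FG.
Qed.

Lemma C1B F G : C1_on X F -> C1_on X G -> C1_on X (fun x => F x - G x).
Proof.
move=> /(C1_derives oX 0) dF /(C1_derives oX 0) dG.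
exact: derives_C1 (derivesB oX dF dG).
Qed.

Lemma C1M F G : C1_on X F -> C1_on X G -> C1_on X (fun x => F x * G x).
Proof.
move=> /(C1_derives oX 0) dF /(C1_derives oX 0) dG.
exact: derives_C1 (derivesM dF dG).
Qed.

Lemma C1Z c F : C1_on X F -> C1_on X (fun x => c * F x).
Proof. by move=> /(C1_derives oX 0) dF; apply: derives_C1 (derivesZ oX c dF). Qed.

Lemma C1_sum (I : Type) (r : seq I) (P : pred I) (F : I -> 'cV[R]_n -> R) :
  (forall i, P i -> C1_on X (F i)) -> C1_on X (fun x => \sum_(i <- r | P i) F i x).
Proof.
move=> cF; apply: (derives_C1 (V := fun _ x => 0 *m x)
  (D := fun _ x => \sum_(i <- r | P i) lin_op 0 (F i) x)).
apply: (derives_sum oX r (F := fun i _ => F i) (D := fun i _ => lin_op 0 (F i))).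
by move=> i Pi; apply: C1_derives (cF i Pi).
Qed.

Lemma C1V F : C1_on X F -> (forall x, X x -> F x != 0) -> C1_on X (fun x => (F x)^-1).
Proof.
move=> /(C1_derives oX 0) dF F0; apply: derives_C1.
apply: (derives_comp dF (g := GRing.inv) (g' := fun y => - y ^- 2))
  => [t x _ Xx|t x _ Xx].
  split; first by apply: derivableV; rewrite ?F0.
  by rewrite deriveV ?F0 // derive_id [RHS]/(- _); exact: mulr1.
apply: continuousN; apply: continuousV; first by rewrite expf_neq0 ?F0.
exact: exprn_continuous.
Qed.

Lemma C1_dot nu : C1_on X (dot nu).
Proof. exact: derives_C1 (@derives_dot _ _ setT X (fun _ _ => 0) nu). Qed.

End C1Closure.

(** * Differentiation of the functional system *)

Lemma derives_convolution (R : realType) (n : nat) (J : set R) (X : set 'cV[R]_n)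
    V k (Y DY L DL : nat -> R -> 'cV[R]_n -> R) :
  open X ->
  (forall i, (i <= k)%N -> derives J X V (Y i) (DY i)) ->
  (forall i, (i <= k)%N -> derives J X V (L i) (DL i)) ->
  derives J X V
    (fun t x => \sum_(i < k.+1) 'C(k, i)%:R * Y i t x * L (k - i)%N t x)
    (fun t x => \sum_(i < k.+1) 'C(k, i)%:R *
       (DY i t x * L (k - i)%N t x + Y i t x * DL (k - i)%N t x)).
Proof.
move=> oX dY dL; apply: derives_sum => // i _; have ik : (i <= k)%N by rewrite -ltnS.
apply: (derives_ext oX (derivesZ oX 'C(k, i)%:R
  (derivesM (dY i ik) (dL (k - i)%N (leq_subr _ _))))) => // t x _ _.
exact: mulrA.
Qed.

Section FunctionalSystem.
Context {R : realType} {n : nat} (X : set 'cV[R]_n) (oX : open X).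

(** The equation of index [k] can be solved for [Y k], whose coefficient [L 0] has no zero on [X];
    the other terms involve earlier [Y i]. This supplies the smoothness of the [Psi], which are
    given only as solutions of the functional system. *)
Lemma convolution_C1 (N : nat) (L U Y : nat -> 'cV[R]_n -> R) :
  (forall k, (k < N)%N -> C1_on X (L k)) ->
  (forall k, (k < N)%N -> C1_on X (U k)) ->
  (forall x, X x -> L 0%N x != 0) ->
  (forall k x, (k < N)%N -> X x ->
     U k x = \sum_(i < k.+1) 'C(k, i)%:R * Y i x * L (k - i)%N x) ->
  forall k, (k < N)%N -> C1_on X (Y k).
Proof.
move=> cL cU L0 EU; elim/ltn_ind => k IH kN.
pose S x := \sum_(i < k) 'C(k, i)%:R * Y i x * L (k - i)%N x.
have cS : C1_on X S.
  apply: C1_sum => // i _; apply: C1M => //; last first.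
    by apply: cL; apply: leq_ltn_trans kN; exact: leq_subr.
  apply: C1Z => //; apply: IH => //; exact: ltn_trans kN.
have cV := C1V oX (cL 0%N (leq_ltn_trans (leq0n _) kN)) L0.
apply: (C1_ext oX (C1M oX (C1B oX (cU k kN) cS) cV)) => x Xx.
rewrite EU // big_ord_recr /= binn mul1r subnn [X in X - _]addrC addrK.
by rewrite mulfK ?L0.
Qed.

Context (N : nat) (A B : 'M[R]_n) (AB : comm_mx A B) (lamB : R).
Context (nu : nat -> 'cV[R]_n) (Psi : nat -> 'cV[R]_n -> R).
Context (nu0X : forall x, X x -> dot (nu 0%N) x != 0).
Context (genB : forall k, (k < N.+1)%N ->
  B^T *m nu k = lamB *: nu k + k%:R *: nu k.-1).
Context (EPsi : forall k x, (k < N)%N -> X x ->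
  dot (nu k.+1) x =
    \sum_(i < k.+1) 'C(k, i)%:R * Psi i.+1 x * dot (nu (k - i)%N) x).

Lemma functional_system_C1 k : (k < N)%N -> C1_on X (Psi k.+1).
Proof.
apply: (@convolution_C1 N (fun k => dot (nu k)) (fun k => dot (nu k.+1))
  (fun k => Psi k.+1)) => // *; exact: C1_dot.
Qed.

Lemma dot_generalized k x : (k < N.+1)%N ->
  dot (nu k) (B *m x) = lamB * dot (nu k) x + k%:R * dot (nu k.-1) x.
Proof. by move=> kN; rewrite dot_mulmx genB // dotDl !dotZl. Qed.

Lemma lin_op_convolution (C : 'M[R]_n) k x : (k < N)%N -> X x ->
  dot (nu k.+1) (C *m x) =
    \sum_(i < k.+1) 'C(k, i)%:R * (lin_op C (Psi i.+1) x * dot (nu (k - i)%N) x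
      + Psi i.+1 x * dot (nu (k - i)%N) (C *m x)).
Proof.
move=> kN Xx.
have dL i := @derives_dot _ _ setT X (fun _ x => C *m x) (nu i).
have := @derives_unique _ _ X oX C _ _ _ _ 0 x (dL k.+1)
  (derives_convolution oX (Y := fun i _ => Psi i.+1)
    (DY := fun i _ => lin_op C (Psi i.+1)) (L := fun i _ => dot (nu i)) (k := k)
    _ (fun i _ => dL i)).
apply=> //.
- by move=> i ik; apply: C1_derives => //; apply: functional_system_C1;
    exact: leq_ltn_trans kN.
- by move=> y; exact: EPsi.
Qed.

(** Differentiating the equation for [nu k.+1] along [B] gives [k + 1] copies of [dot (nu k) x] on
    the left and, by [convolution_shift], [k] copies on the right. The surplus copy is the
    convolution of the Kronecker delta with the [dot (nu i) x], so [convolution_inj] identifies the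
    coefficients. *)
Lemma lin_op_Psi k x : (k < N)%N -> X x -> lin_op B (Psi k.+1) x = (k == 0%N)%:R.
Proof.
move=> kN Xx; apply/eqP; rewrite -subr_eq0; apply/eqP.
apply: (@convolution_inj _ N (fun k => dot (nu k) x)
  (fun k => lin_op B (Psi k.+1) x - (k == 0%N)%:R)) kN => [a /eqP|{}k kN].
  by rewrite mulf_eq0 (negPf (nu0X Xx)) orbF => /eqP.
have := @lin_op_convolution B k x kN Xx; rewrite dot_generalized //.
rewrite (eq_bigr (fun i : 'I_k.+1 =>
  'C(k, i)%:R * lin_op B (Psi i.+1) x * dot (nu (k - i)%N) x
  + 'C(k, i)%:R * (lamB * (Psi i.+1 x * dot (nu (k - i)%N) x)
     + (k - i)%:R * (Psi i.+1 x * dot (nu (k - i).-1) x)))); last first.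
  by move=> i _; rewrite dot_generalized; [ring|lia].
rewrite big_split /= (@convolution_shift _ (fun k => dot (nu k) x)
   (fun i l => Psi i.+1 x * dot (nu l) x)); last first.
  move=> l lk; rewrite EPsi //; last lia.
  by apply: eq_bigr => i _; rewrite mulrA.
rewrite -natr1 mulrDl mul1r => E.
have {}E :
  \sum_(i < k.+1) 'C(k, i)%:R * lin_op B (Psi i.+1) x * dot (nu (k - i)%N) x
    = dot (nu k) x.
  by move: E; lra.
rewrite -[RHS](subrr (dot (nu k) x)) -{1}E.
rewrite -(convolution_delta k (fun i => dot (nu i) x)).
rewrite -sumrB; apply: eq_bigr => i _; ring.
Qed.

Lemma lin_op_lin_op_Psi k : (k < N)%N ->
  C1_on X (lin_op A (Psi k.+1)) /\
  forall x, X x -> lin_op B (lin_op A (Psi k.+1)) x = 0.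
Proof.
pose M k x := dot (nu k) (A *m x).
have EM l y : M l y = dot (A^T *m nu l) y by apply: dot_mulmx.
have cM l : C1_on X (M l).
  by apply: (C1_ext oX (C1_dot X (A^T *m nu l))) => y _; rewrite EM.
(* Moving [S l] to the left leaves a convolution of the unknown [lin_op A (Psi i.+1)] with the
   [dot (nu i)], so [convolution_C1] applies to them. *)
pose S l x := \sum_(i < l.+1) 'C(l, i)%:R * Psi i.+1 x * M (l - i)%N x.
have cS l : (l < N)%N -> C1_on X (S l).
  move=> lN; apply: C1_sum => // i _; apply: C1M => //; apply: C1Z => //.
  by apply: functional_system_C1; apply: leq_ltn_trans lN; rewrite -ltnS.
have EQ l y : (l < N)%N -> X y -> M l.+1 y - S l y =
    \sum_(i < l.+1) 'C(l, i)%:R * lin_op A (Psi i.+1) y * dot (nu (l - i)%N) y.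
  move=> lN Xy; rewrite /M lin_op_convolution // /S -sumrB.
  by apply: eq_bigr => i _; rewrite mulrDr !mulrA addrK.
have cQ l : (l < N)%N -> C1_on X (lin_op A (Psi l.+1)).
  apply: (@convolution_C1 N (fun k => dot (nu k)) (fun l x => M l.+1 x - S l x)
    (fun l => lin_op A (Psi l.+1))) => //.
    by move=> *; exact: C1_dot.
  by move=> l' l'N; apply: C1B => //; exact: cS.
move=> kN; split; first exact: cQ.
move=> x Xx; have L0 := nu0X Xx.
(* As [A] and [B] commute, the vectors [A^T *m nu l] satisfy the same chain relations for [B^T] as
   the [nu l]. *)
have DM l y : (l < N.+1)%N ->
    dot (A^T *m nu l) (B *m y) = lamB * M l y + l%:R * M l.-1 y.
  move=> lN; rewrite dot_mulmx mulmxA -trmx_mul AB trmx_mul -mulmxA genB //.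
  by rewrite mulmxDr -!scalemxAr dotDl !dotZl !EM.
apply: (@convolution_inj _ N (fun k => dot (nu k) x)
  (fun k => lin_op B (lin_op A (Psi k.+1)) x)) kN => [a /eqP|{}k kN].
  by rewrite mulf_eq0 (negPf L0) orbF => /eqP.
have dM l : derives setT X (fun _ x => B *m x) (fun _ => M l)
    (fun _ x => dot (A^T *m nu l) (B *m x)).
  by apply: (derives_ext oX (@derives_dot _ _ setT X _ (A^T *m nu l))) => // *; rewrite EM.
have dQL := derives_convolution oX (k := k)
  (Y := fun i _ => lin_op A (Psi i.+1))
  (DY := fun i _ => lin_op B (lin_op A (Psi i.+1)))
  (fun i ik => C1_derives oX B (cQ i (leq_ltn_trans ik kN)))
  (fun i _ => @derives_dot _ _ setT X (fun _ x => B *m x) (nu i)).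
have dPM := derives_convolution oX (k := k)
  (Y := fun i _ => Psi i.+1) (DY := fun i _ => lin_op B (Psi i.+1))
  (fun i ik => C1_derives oX B (functional_system_C1 (leq_ltn_trans ik kN)))
  (fun i _ => dM i).
have := @derives_unique _ _ X oX B _ _ _ _ 0 x (dM k.+1) (derivesD dQL dPM) _ Xx.
rewrite DM // => E.
have {}E : lamB * M k.+1 x + k.+1%:R * M k x =
    \sum_(i < k.+1) 'C(k, i)%:R * lin_op B (lin_op A (Psi i.+1)) x * dot (nu (k - i)%N) x
    + M k x + (lamB * M k.+1 x + k%:R * M k x).
  rewrite E; last by move=> y Xy; rewrite -EQ // /S subrK.
  pose W i l := lin_op A (Psi i.+1) x * dot (nu l) x + Psi i.+1 x * M l x.
  have <- : \sum_(i < k.+1) 'C(k, i)%:R *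
      (lamB * W i (k - i)%N + (k - i)%:R * W i (k - i).-1)
      = lamB * M k.+1 x + k%:R * M k x.
    apply: (@convolution_shift _ (fun l => M l x)) => l lk.
    have lN : (l < N)%N by exact: leq_ltn_trans kN.
    rewrite -[LHS](subrK (S l x)) EQ // /S /W -big_split /=.
    by apply: eq_bigr => i _; ring.
  (* By [lin_op_Psi] the terms with [lin_op B (Psi i.+1)] contribute one extra [M k x]. It balances
     [k + 1] against [k], and only the convolution of the second derivatives remains, equal to
     zero. *)
  rewrite -(convolution_delta k (fun l => M l x)).
  rewrite -!big_split /=; apply: eq_bigr => i _.
  have ik : (i <= k)%N by rewrite -ltnS.
  rewrite /W DM ?dot_generalized ?lin_op_Psi //; try lia.
  ring.
by move: E; rewrite -natr1 mulrDl mul1r; lra.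
Qed.

End FunctionalSystem.

(** * Continuity and differentiation relative to J *)

Section RelativeContinuity.
Context {R : realType} (J : set R).
Implicit Types (g h k : R -> R).

Lemma within_continuousM g h :
  {within J, continuous g} -> {within J, continuous h} ->
  {within J, continuous (fun t => g t * h t)}.
Proof. by move=> gc hc t; apply: cvgM; [apply: gc|apply: hc]. Qed.

Lemma within_continuousD g h :
  {within J, continuous g} -> {within J, continuous h} ->
  {within J, continuous (fun t => g t + h t)}.
Proof. by move=> gc hc t; apply: cvgD; [apply: gc|apply: hc]. Qed.

Lemma within_continuous_sum (I : Type) (r : seq I) (P : pred I) (g : I -> R -> R) :
  (forall i, P i -> {within J, continuous (g i)}) ->
  {within J, continuous (fun t => \sum_(i <- r | P i) g i t)}.
Proof.
move=> gc t; apply: cvg_big => [|i Pi]; first exact: add_continuous.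
exact: gc.
Qed.

Lemma within_continuous_eq g h : {within J, continuous g} ->
  (forall t, J t -> g t = h t) -> {within J, continuous h}.
Proof.
by move=> gc gh; apply: subspace_eq_continuous gc => t /set_mem; exact: gh.
Qed.

Lemma oint_time_derive t0 g k : is_interval J -> J t0 ->
  {within J, continuous k} -> (forall t, J t -> g t = oint t0 t k) ->
  time_derive J g k.
Proof.
move=> HJ Jt0 kc gE t Jt; rewrite /quot_cvg gE //.
apply: cvg_trans (oint_derive HJ kc Jt0 Jt); apply: fmap_within_eq => h /set_mem Jth.
by rewrite (gE _ Jth).
Qed.

Lemma time_derive_continuous g k : time_derive J g k -> {within J, continuous g}.
Proof.
by move=> gk; apply/subspace_continuousP => t Jt; exact: time_derive_cvg gk Jt.
Qed.

End RelativeContinuity.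

(** * First integrals of the nonhomogeneous system *)

Theorem theorem2p14 (R : realType) (n m s : nat)
    (J : set R) (alpha : 'I_m -> R -> R) (A : 'I_m -> 'M[R]_n)
    (f : R -> 'cV[R]_n) (zeta : 'I_m)
    (lambda : 'I_m -> R) (nu : nat -> 'cV[R]_n)
    (X : set 'cV[R]_n) (Psi : nat -> 'cV[R]_n -> R) (t0 : R)
    (* the system *)
    (HJ : is_interval J)
    (Halpha : forall j, {within J, continuous (alpha j)})
    (Hindep : lin_indep_on J alpha)
    (Hcomm : forall i j, comm_mx (A i) (A j))
    (Hf : {within J, continuous f})
    (* (i) *)
    (Hnu0 : nu 0%N != 0)
    (Heig : forall j, (A j)^T *m nu 0%N = lambda j *: nu 0%N)
    (* (ii) *)
    (Hs : (2 <= s)%N)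
    (Hdiv : elementary_divisor (A zeta)^T (lambda zeta) s)
    (Hnu : forall theta, (0 < theta < s)%N -> nu theta != 0)
    (Hgen : forall theta, (0 < theta < s)%N ->
       ((A zeta)^T - (lambda zeta)%:M) *m nu theta
         = theta%:R *: nu theta.-1)
    (* the domain and the functional system *)
    (HX : domain X)
    (HXnu0 : X `<=` [set x | dot (nu 0%N) x != 0])
    (HPsi : forall theta x, (0 < theta < s)%N -> X x ->
       dot (nu theta) x =
         \sum_(1 <= rho < theta.+1)
            'C(theta.-1, rho.-1)%:R * Psi rho x * dot (nu (theta - rho)%N) x)
    (* (iii) *)
    (Hnofi : forall j theta, j != zeta -> (0 < theta < s)%N ->
       ~ (autonomous_first_integral X (A zeta) (lin_op (A j) (Psi theta)) /\
          ~ constant_on X (lin_op (A j) (Psi theta))))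
    (Ht0 : J t0) :
  (forall j theta, (0 < theta < s)%N ->
     constant_on X (lin_op (A j) (Psi theta))) /\
  forall (muc : 'I_m -> nat -> R) (mu : nat -> R -> R) (phi : R -> R)
         (K : nat -> nat -> R -> R) (C : nat -> R -> R)
         (F : nat -> R -> 'cV[R]_n -> R),
    (forall j theta x, (0 < theta < s)%N -> X x ->
       lin_op (A j) (Psi theta) x = muc j theta) ->
    (forall theta t, (0 < theta < s)%N -> J t ->
       mu theta t = \sum_j muc j theta * alpha j t) ->
    (forall t, J t ->
       phi t = expR (- oint t0 t (fun tau => \sum_j lambda j * alpha j tau))) ->
    (* K theta rho.-1 *)
    (forall theta rho t, (0 < theta < s)%N -> (0 < rho <= theta)%N -> J t ->
       K theta rho.-1 t = oint t0 t (fun tau =>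
         'C(theta, rho.-1)%:R * mu (theta - rho + 1)%N tau
         + \sum_(1 <= eta < (theta - rho).+1)
             'C(theta, eta)%:R * mu eta tau * K (theta - eta)%N rho.-1 tau)) ->
    (forall theta t, (theta < s)%N -> J t ->
       C theta t = oint t0 t (fun tau =>
         dot (nu theta) (f tau) * phi tau
         + \sum_(1 <= rho < theta.+1)
             'C(theta, rho)%:R * mu rho tau * C (theta - rho)%N tau)) ->
    (forall theta t x, (theta < s)%N -> J t -> X x ->
       F theta t x =
         dot (nu theta) x * phi t
         - \sum_(1 <= rho < theta.+1) K theta rho.-1 t * F rho.-1 t x
         - C theta t) ->
    forall theta, (theta < s)%N ->
      first_integral J X
        (fun t x => \sum_j alpha j t *: (A j *m x) + f t) (F theta).
Proof.
have [oX _] := HX.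
have nu0X x : X x -> dot (nu 0%N) x != 0 by exact: HXnu0.
case: s Hs Hdiv Hnu Hgen HPsi Hnofi => // N _ _ _ Hgen HPsi Hnofi.
have genB k : (k < N.+1)%N ->
    (A zeta)^T *m nu k = lambda zeta *: nu k + k%:R *: nu k.-1.
  (* For [k = 0] the term with [nu k.-1] has coefficient zero, so the chain relation includes the
     eigenvector equation. *)
  case: k => [|k] kN; first by rewrite scale0r addr0 Heig.
  by rewrite -Hgen // mulmxBl mul_scalar_mx addrC subrK.
have EPsi k x : (k < N)%N -> X x -> dot (nu k.+1) x =
    \sum_(i < k.+1) 'C(k, i)%:R * Psi i.+1 x * dot (nu (k - i)%N) x.
  by move=> kN Xx; rewrite HPsi // big_add1 big_mkord.
have EaPsi := lin_op_Psi oX nu0X genB EPsi.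
split=> [j [//|k] /= kN|muc mu phi K C F Emuc Emu Ephi EK EC EF].
  have [->|jz] := eqVneq j zeta.
    by exists (k == 0%N)%:R => x; exact: EaPsi.
  have [cQ aQ] := lin_op_lin_op_Psi oX (Hcomm j zeta) nu0X genB EPsi kN.
  (* Were it not constant, this first integral of the [zeta] system would contradict (iii). *)
  apply: contrapT => nc; apply: (Hnofi j k.+1 jz kN); split=> //.
  by apply: (derives_first_integral (C1_derives oX (A zeta) cQ)) => t x _; exact: aQ.
have {EK} EK k i t : (k < N.+1)%N -> (i < k)%N -> J t ->
    K k i t = oint t0 t (fun tau => 'C(k, i)%:R * mu (k - i)%N tau
      + \sum_(j < k - i.+1) 'C(k, j.+1)%:R * mu j.+1 tau * K (k - j.+1)%N i tau).
  move=> kN ik Jt; rewrite (EK k i.+1) // ?(leq_ltn_trans (leq0n _) ik) //.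
  congr oint; apply/funext => tau; rewrite big_add1 big_mkord addn1.
  by rewrite -(subnSK ik).
have {EC} EC k t : (k < N.+1)%N -> J t ->
    C k t = oint t0 t (fun tau => dot (nu k) (f tau) * phi tau
      + \sum_(i < k) 'C(k, i.+1)%:R * mu i.+1 tau * C (k - i.+1)%N tau).
  move=> kN Jt; rewrite EC //.
  by congr oint; apply/funext => tau; rewrite big_add1 big_mkord.
pose G k t x := dot (nu k) x * phi t - C k t.
have {EF} EF k t x : (k < N.+1)%N -> J t -> X x ->
    F k t x = G k t x - \sum_(i < k) K k i t * F i t x.
  by move=> kN Jt Xx; rewrite EF // big_add1 big_mkord addrAC.
have ccst (c : R) : {within J, continuous (fun _ : R => c)}.
  by move=> t; exact: cvg_cst.
have cmu k : (0 < k < N.+1)%N -> {within J, continuous (mu k)}.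
  move=> kN; apply: (within_continuous_eq _ (fun t Jt => esym (Emu k t kN Jt))).
  by apply: within_continuous_sum => j _; apply: within_continuousM.
pose Lam t := \sum_j lambda j * alpha j t.
have cLam : {within J, continuous Lam}.
  by apply: within_continuous_sum => j _; apply: within_continuousM.
have dLam := oint_time_derive HJ Ht0 cLam (fun t _ => erefl).
have cphi : {within J, continuous phi}.
  apply: (@within_continuous_eq _ _ (fun t => expR (- oint t0 t Lam)));
    last by move=> t Jt; rewrite Ephi.
  move=> t; apply: continuous_comp; last exact: continuous_expR.
  by apply: cvgN; apply: (time_derive_continuous dLam).
have cf nu' : {within J, continuous (fun t => dot nu' (f t))}.
  apply: within_continuous_sum => i _; apply: within_continuousM => // t.
  exact: (@cvg_comp _ _ _ f (fun y : 'cV[R]_n => y i 0) _ _ _ (Hf t)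
    (@coord_continuous _ _ _ i 0 (f t))).
pose K' k i t := 'C(k, i)%:R * mu (k - i)%N t
      + \sum_(j < k - i.+1) 'C(k, j.+1)%:R * mu j.+1 t * K (k - j.+1)%N i t.
(* Strong induction on [k]: the integrand [K' k i] involves only [K l i] with [l < k], continuous
   because already differentiable. The same scheme handles the [C k]. *)
have cK' k i : (k < N.+1)%N -> (i < k)%N ->
    {within J, continuous (K' k i)} /\ time_derive J (K k i) (K' k i).
  elim/ltn_ind: k i => k IH i kN ik.
  have c : {within J, continuous (K' k i)}.
    apply: within_continuousD.
      by apply: within_continuousM => //; apply: cmu; lia.
    apply: within_continuous_sum => j _; have jk := ltn_ord j.
    apply: within_continuousM; last first.
      have [|||_ dK] := IH (k - j.+1)%N _ i; [lia..|].
      exact: time_derive_continuous dK.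
    by apply: within_continuousM => //; apply: cmu; lia.
  by split=> //; apply: (oint_time_derive HJ Ht0 c) => t; exact: EK.
pose C' k t := dot (nu k) (f t) * phi t
      + \sum_(i < k) 'C(k, i.+1)%:R * mu i.+1 t * C (k - i.+1)%N t.
have cC' k : (k < N.+1)%N ->
    {within J, continuous (C' k)} /\ time_derive J (C k) (C' k).
  elim/ltn_ind: k => k IH kN.
  have c : {within J, continuous (C' k)}.
    apply: within_continuousD; first exact: within_continuousM.
    apply: within_continuous_sum => j _; have jk := ltn_ord j.
    apply: within_continuousM; last first.
      have [||_ dC] := IH (k - j.+1)%N; [lia..|].
      exact: time_derive_continuous dC.
    by apply: within_continuousM => //; apply: cmu; lia.
  by split=> //; apply: (oint_time_derive HJ Ht0 c) => t; exact: EC.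
pose V t x := \sum_j alpha j t *: (A j *m x) + f t.
have dphi : derives J X V (fun t _ => phi t) (fun t _ => - (Lam t * phi t)).
  have dI := @derivesZ _ _ _ _ oX V (-1) _ _ (derives_time X V dLam cLam).
  have := derives_comp dI (g := expR) (g' := expR)
    (fun _ _ _ _ => is_derive_expR _) (fun _ _ _ _ => @continuous_expR _ _).
  move=> dE; apply: (derives_ext oX dE) => t x Jt _; rewrite !mulN1r Ephi //.
  by rewrite mulrN mulrC.
have dotV k t x : (k < N.+1)%N -> J t -> X x ->
    dot (nu k) (V t x) = Lam t * dot (nu k) x
      + \sum_(i < k) 'C(k, i.+1)%:R * mu i.+1 t * dot (nu (k - i.+1)%N) x
      + dot (nu k) (f t).
  move=> kN Jt Xx.
  have E j : dot (nu k) (A j *m x) = lambda j * dot (nu k) x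
      + \sum_(i < k) 'C(k, i.+1)%:R * muc j i.+1 * dot (nu (k - i.+1)%N) x.
    (* Here [L], [P], [N] are the values at [x] of [dot (nu k)], of the [Psi k] and of the
       derivatives along [A j]. The recurrence for [N] is the differentiated functional system with
       the constants [muc j] inserted. *)
    apply: (@convolution_eigen _ N.+1 (fun k => dot (nu k) x) (fun k => Psi k x)
      (fun k => dot (nu k) (A j *m x)) (muc j)) => //.
    - by rewrite dot_mulmx Heig; exact: dotZl.
    - by move=> l lN; exact: EPsi.
    - move=> l lN; rewrite (lin_op_convolution oX nu0X EPsi) //.
      apply: eq_bigr => i _; rewrite (Emuc j i.+1) //=.
      by have := ltn_ord i; lia.
  rewrite /V dotDr dot_sumr; congr (_ + _).
  under eq_bigr do rewrite dotZr E mulrDr.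
  rewrite big_split /= mulr_suml; congr (_ + _).
    by apply: eq_bigr => j _; ring.
  under eq_bigr do rewrite mulr_sumr.
  rewrite exchange_big; apply: eq_bigr => i _ /=.
  rewrite Emu; [|by have := ltn_ord i; lia|by []].
  rewrite mulr_sumr mulr_suml; apply: eq_bigr => j _; ring.
have dG k : (k < N.+1)%N -> derives J X V (G k)
    (fun t x => \sum_(i < k) 'C(k, i.+1)%:R * mu i.+1 t * G (k - i.+1)%N t x).
  move=> kN; have [c dC] := cC' k kN.
  have := derivesB oX (derivesM (derives_dot J X V (nu k)) dphi) (derives_time X V dC c).
  move=> dE; apply: (derives_ext oX dE) => // t x Jt Xx.
  (* The terms in [Lam] cancel against the derivative of [phi], and those in [f] against the first
     term of [C']. *)
  rewrite dotV // /C' /G.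
  under [RHS]eq_bigr do rewrite mulrBr mulrA.
  rewrite sumrB -mulr_suml; ring.
move=> k kN; suff : derives J X V (F k) (fun _ _ => 0).
  by move/derives_first_integral; apply.
(* By induction the earlier [F i] have derivative zero, so in the sum of the [K k i * F i] only the
   [K k i] get differentiated. The result equals the derivative of [G k] by
   [convolution_triangular]. *)
elim/ltn_ind: k kN => k IH kN.
have dKF : derives J X V (fun t x => \sum_(i < k) K k i t * F i t x)
    (fun t x => \sum_(i < k) K' k i t * F i t x).
  apply: derives_sum => // i _; have ik := ltn_ord i.
  have [c dK] := cK' k i kN ik.
  have := derivesM (derives_time X V dK c) (IH i ik (ltn_trans ik kN)).
  by move=> dE; apply: (derives_ext oX dE) => // t x _ _; rewrite mulr0 addr0.
apply: (derives_ext oX (derivesB oX (dG k kN) dKF)) => t x Jt Xx.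
  by rewrite EF.
rewrite (@convolution_triangular _ (fun k => G k t x) (fun k => F k t x)
  (fun k => mu k t) (fun k i => K k i t)) ?subrr // => l lk.
by rewrite EF ?subrK //; exact: ltn_trans kN.
Qed.
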